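(* Let $P\subset\mathbb{R}^2$ be a polygon with vertices $\mathbf{p}_1,\ldots,\mathbf{p}_n$ ordered anticlockwise. For every $\mathbf{x}\in P$ and every $i=1,\ldots,n$, the gradient (with respect to $\mathbf{x}$) of the function $w_i=(t_{i-1}+t_i)/r_i$ is $$\nabla w_i=\frac{1}{2r_i}\left(u_{i-1}\,\mathbf{e}_{i-1}^{\perp}-u_i\,\mathbf{e}_{i+1}^{\perp}\right),$$ where $$u_j:=\left(\frac{1}{r_j}+\frac{1}{r_{j+1}}\right)(1+t_j^2).$$
   Context: A polygon $P\subset\mathbb{R}^2$ is the open region bounded by a simple closed polygonal curve with vertices $\mathbf{p}_1,\ldots,\mathbf{p}_n$ ordered anticlockwise (convex or non-convex). Indices are treated cyclically modulo $n$. For $\mathbf{a}=(a_1,a_2)$, $\mathbf{b}=(b_1,b_2)$ in $\mathbb{R}^2$ write $\mathbf{a}\times\mathbf{b}:=a_1b_2-a_2b_1$ and $\mathbf{a}^{\perp}:=(-a_2,a_1)$ (rotation by the positive angle $\pi/2$). For $\mathbf{x}\in P$ let $r_i:=\|\mathbf{p}_i-\mathbf{x}\|$ (Euclidean distance), $\mathbf{e}_i:=(\mathbf{p}_i-\mathbf{x})/r_i$, and let $\alpha_i\in(-\pi,\pi)$ be the signed angle at $\mathbf{x}$ in the triangle $[\mathbf{x},\mathbf{p}_i,\mathbf{p}_{i+1}]$, i.e. $\cos\alpha_i=\mathbf{e}_i\cdot\mathbf{e}_{i+1}$ and $\sin\alpha_i=\mathbf{e}_i\times\mathbf{e}_{i+1}$.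 Let $t_i:=\tan(\alpha_i/2)$ and $w_i:=(t_{i-1}+t_i)/r_i$. All of these are functions of $\mathbf{x}\in P$. (The $w_i$ are the homogeneous form of the mean value coordinates $\phi_i=w_i/\sum_j w_j$.) *)

(* Defs.v *)
From HB Require Import structures.
From mathcomp Require Import all_boot all_order all_algebra.
From mathcomp Require Import all_classical all_reals all_analysis.

Set Implicit Arguments.
Unset Strict Implicit.
Unset Printing Implicit Defensive.

Import Order.TTheory GRing.Theory Num.Theory.
Import numFieldNormedType.Exports.

Local Open Scope classical_set_scope.
Local Open Scope ring_scope.

Definition dot (R : realType) (a b : 'rV[R]_2) : R :=
  a 0 0 * b 0 0 + a 0 1 * b 0 1.

Definition cross (R : realType) (a b : 'rV[R]_2) : R :=
  a 0 0 * b 0 1 - a 0 1 * b 0 0.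

Definition perp (R : realType) (a : 'rV[R]_2) : 'rV[R]_2 :=
  \row_j (if j == 0 then - a 0 1 else a 0 0).

(* The norm [`|_|] of ['rV[R]_2] is the sup norm, hence this definition. *)
Definition enorm (R : realType) (a : 'rV[R]_2) : R := Num.sqrt (dot a a).

Definition gradient (R : realType) (f : 'rV[R]_2 -> R) (x : 'rV[R]_2) :
  'rV[R]_2 := \row_j 'D_(delta_mx 0 j) f x.

(* Vertices are indexed by ['I_n]; [ordS] and [ord_pred] are the cyclic
   successor and predecessor. *)
Definition edge_point (R : realType) (n : nat) (p : 'I_n -> 'rV[R]_2)
  (i : 'I_n) (s : R) : 'rV[R]_2 := p i + s *: (p (ordS i) - p i).

Definition polygonal_curve (R : realType) (n : nat) (p : 'I_n -> 'rV[R]_2) :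
  set 'rV[R]_2 :=
  [set q | exists i s, 0 <= s <= 1 /\ q = edge_point p i s].

(* Injectivity of the closed curve, parametrised by ['I_n * [0, 1[]. It rules
   out repeated vertices, crossings, overlapping edges, and (for [0 < n])
   forces [2 < n]. *)
Definition simple_polygonal_curve (R : realType) (n : nat)
  (p : 'I_n -> 'rV[R]_2) : Prop :=
  forall (i j : 'I_n) (s t : R), 0 <= s < 1 -> 0 <= t < 1 ->
    edge_point p i s = edge_point p j t -> i = j /\ s = t.

(* The open region bounded by the curve: the bounded component of the
   complement of the curve. *)
Definition polygon_region (R : realType) (n : nat) (p : 'I_n -> 'rV[R]_2) :
  set 'rV[R]_2 :=
  [set x | (~` polygonal_curve p) x /\
           bounded_set (connected_component (~` polygonal_curve p) x)].

(* The region lies to the left of every edge, at each relative interior point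
   of that edge. *)
Definition anticlockwise (R : realType) (n : nat) (p : 'I_n -> 'rV[R]_2) :
  Prop :=
  forall (i : 'I_n) (s : R), 0 < s < 1 ->
    \forall h \near 0^'+,
      polygon_region p (edge_point p i s + h *: perp (p (ordS i) - p i)).

(* The signed angle from [a] to [b] in ]-pi, pi[, for unit vectors [a], [b]
   with [b <> - a]; such an angle then exists and is unique, so that the
   default value 0 of [xget] is not used. *)
Definition signed_angle (R : realType) (a b : 'rV[R]_2) : R :=
  xget 0 [set alpha : R |
    [/\ - pi < alpha < pi, cos alpha = dot a b & sin alpha = cross a b]].

Definition mv_r (R : realType) (n : nat) (p : 'I_n -> 'rV[R]_2) (i : 'I_n)
  (x : 'rV[R]_2) : R := enorm (p i - x).

Definition mv_e (R : realType) (n : nat) (p : 'I_n -> 'rV[R]_2) (i : 'I_n)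
  (x : 'rV[R]_2) : 'rV[R]_2 := (mv_r p i x)^-1 *: (p i - x).

Definition mv_alpha (R : realType) (n : nat) (p : 'I_n -> 'rV[R]_2) (i : 'I_n)
  (x : 'rV[R]_2) : R := signed_angle (mv_e p i x) (mv_e p (ordS i) x).

Definition mv_t (R : realType) (n : nat) (p : 'I_n -> 'rV[R]_2) (i : 'I_n)
  (x : 'rV[R]_2) : R := tan (mv_alpha p i x / 2).

Definition mv_w (R : realType) (n : nat) (p : 'I_n -> 'rV[R]_2) (i : 'I_n)
  (x : 'rV[R]_2) : R := (mv_t p (ord_pred i) x + mv_t p i x) / mv_r p i x.

Definition mv_u (R : realType) (n : nat) (p : 'I_n -> 'rV[R]_2) (j : 'I_n)
  (x : 'rV[R]_2) : R :=
  ((mv_r p j x)^-1 + (mv_r p (ordS j) x)^-1) * (1 + mv_t p j x ^+ 2).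

(* Main.v *)
Require Import Defs.
From HB Require Import structures.
From mathcomp Require Import all_boot all_order all_algebra.
From mathcomp Require Import all_classical all_reals all_analysis.
From mathcomp Require Import ring lra.

Set Implicit Arguments.
Unset Strict Implicit.
Unset Printing Implicit Defensive.

Import Order.TTheory GRing.Theory Num.Theory.
Import numFieldNormedType.Exports.

Local Open Scope classical_set_scope.
Local Open Scope ring_scope.

(** Why the formula holds.  A point [x] of the region lies on no edge, so the
    vectors [a := p i - x] and [b := p (ordS i) - x] never point in opposite
    directions, and the half-angle tangent is a smooth function of [x]:
    [tan (alpha / 2) = sin alpha / (1 + cos alpha)
                     = cross a b / (|a| |b| + dot a b)]
    ([tan_half], [tan_signed_angle], [off_segment_neq0]).  The denominator is
    nonzero in a neighbourhood of [x], so the choice of angle in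
    [signed_angle] disappears before anything is differentiated.

    Write [e], [f] for the unit vectors along [a], [b], [r], [r'] for the
    lengths of [a], [b], and [t] for the half-angle tangent.  The gradient of
    the single term [t / r] turns out to be
    [r^-2 e^perp - (2 r)^-1 (r^-1 + r'^-1) (1 + t^2) f^perp]
    ([has_gradient_tan_half_dist]).  The verification is rational arithmetic:
    in the orthogonal frame [(e, e^perp)] the vector [f] has the coordinates
    [(1 - t^2) / (1 + t^2)] and [2 t / (1 + t^2)] ([half_angle_frame]), so that
    no relation between the variables [t], [r], [r'] is left.

    Exchanging the end points of an edge changes the sign of [t], hence the
    weight is a difference of two such terms,
    [w_i = t (p_i, p_(i+1)) / r_i - t (p_i, p_(i-1)) / r_i].
    The contributions [r^-2 e^perp] of the two terms depend on [p_i] alone and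
    cancel; what remains is the asserted gradient. *)

(** * Differentiability is a local property *)

Lemma ord2_cases (j : 'I_2) : j = 0 \/ j = 1.
Proof. by case: j => [[|[|//]] lt_j2]; [left|right]; apply/val_inj. Qed.

(** The first-order expansion at [x] is an asymptotic statement near [x], so it
    passes from [g] to [f], and it determines the differential. *)
Lemma near_eq_is_diff (R : realType) (V W : normedModType R) (f g dg : V -> W)
    (x : V) : {near x, f =1 g} -> is_diff x g dg -> is_diff x f dg.
Proof.
move=> fg [dgx gE].
have fx : f x = g x by exact: nbhs_singleton fg.
have E : f \o shift x = cst (f x) + 'd g x +o_ 0 id.
  apply/eqaddoP => e e0.
  have := dgx => /diff_locally/eqaddoP/(_ e e0).
  have : \forall h \near (0 : V), f (h + x) = g (h + x).
    by have := fg; rewrite (near_shift 0) /= subr0.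
  apply: filterS2 => h /= fgh.
  by rewrite -[(_ - _) h]/(g (h + x) - (g x + 'd g x h)) -fgh -fx.
have dE : 'd f x = 'd g x :> (V -> W).
  by apply: diff_unique E; exact: diff_continuous.
split; last by rewrite dE.
by apply/diff_locallyP; rewrite dE; split => //; exact: diff_continuous.
Qed.

(** * A calculus of gradients in the plane *)

Section GradientCalculus.
Variable R : realType.
Implicit Types (f g : 'rV[R]_2 -> R) (x v w : 'rV[R]_2).

(** Differentiability and the value of the differential are kept together, so
    that both conclusions about a compound function come from one derivation. *)
Definition has_gradient f x w : Prop := is_diff x f (dot w).

Lemma has_gradientE f x w : has_gradient f x w -> gradient f x = w.
Proof.
move=> [df fw]; apply/rowP => j; rewrite mxE deriveE // fw /dot !mxE.
case: (ord2_cases j) => ->.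
- by rewrite /= mulr1 mulr0 addr0.
- by rewrite /= mulr0 mulr1 add0r.
Qed.

Lemma has_gradient_eq f x v w :
  has_gradient f x v -> v = w -> has_gradient f x w.
Proof. by move=> ? <-. Qed.

Lemma has_gradient_cst (c : R) x : has_gradient (fun=> c) x 0.
Proof.
have := is_diff_cst c x; rewrite /has_gradient.
by congr is_diff_def; apply/funext => v; rewrite /dot !mxE /= !mul0r addr0.
Qed.

Lemma has_gradient_coord (j : 'I_2) x :
  has_gradient (fun y => y 0 j) x (delta_mx 0 j).
Proof.
have @c : {linear 'rV[R]_2 -> R}.
  by exists (fun N : 'rV[R]_2 => N 0 j); do 2![eexists]; do ?[constructor];
     rewrite ?mxE// => ? *; rewrite ?mxE//; move=> ?; rewrite !mxE.
have cE : (fun y : 'rV[R]_2 => y 0 j) = c by [].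
split; first exact: differentiable_coord.
rewrite cE diff_lin; last exact: coord_continuous.
rewrite -cE; apply/funext => v; rewrite /dot !mxE /=.
case: (ord2_cases j) => ->.
- by rewrite /= mul1r mul0r addr0.
- by rewrite /= mul0r mul1r add0r.
Qed.

Lemma has_gradientD f g x v w : has_gradient f x v -> has_gradient g x w ->
  has_gradient (fun y => f y + g y) x (v + w).
Proof.
move=> df dg; have := is_diffD df dg; rewrite /has_gradient.
congr is_diff_def; apply/funext => u; rewrite /dot !mxE !fctE; ring.
Qed.

Lemma has_gradientB f g x v w : has_gradient f x v -> has_gradient g x w ->
  has_gradient (fun y => f y - g y) x (v - w).
Proof.
move=> df dg; have := is_diffB df dg; rewrite /has_gradient.
congr is_diff_def; apply/funext => u; rewrite /dot !mxE !fctE; ring.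
Qed.

Lemma has_gradientM f g x v w : has_gradient f x v -> has_gradient g x w ->
  has_gradient (fun y => f y * g y) x (f x *: w + g x *: v).
Proof.
move=> df dg; have := is_diffM df dg; rewrite /has_gradient.
congr is_diff_def; apply/funext => u; rewrite /dot !mxE !fctE /=.
rewrite /GRing.scale /=; ring.
Qed.

Lemma has_gradient_comp (h : R -> R) (d : R) f x w :
  has_gradient f x w -> is_derive (f x) 1 h d ->
  has_gradient (fun y => h (f y)) x (d *: w).
Proof.
move=> df dh.
have hd : is_diff (f x) h (fun u => u * d).
  have hx : differentiable h (f x) by apply/derivable1_diffP; case: dh.
  split=> //; rewrite diff1E //; apply/funext => u.
  by rewrite derive1E derive_val.
have := is_diff_comp df hd; rewrite /has_gradient.
congr is_diff_def; apply/funext => u; rewrite /dot !mxE /=; ring.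
Qed.

Lemma has_gradient_sqrt f x w : has_gradient f x w -> 0 < f x ->
  has_gradient (fun y => Num.sqrt (f y)) x ((2 * Num.sqrt (f x))^-1 *: w).
Proof.
by move=> df f0; apply: has_gradient_comp df _; exact: is_derive1_sqrt.
Qed.

Lemma has_gradientV f x w : has_gradient f x w -> f x != 0 ->
  has_gradient (fun y => (f y)^-1) x (- (f x) ^- 2 *: w).
Proof.
move=> df f0; apply: has_gradient_comp df _.
have := @is_deriveV R id (f x) 1 1 f0 (is_derive_id _ _).
by rewrite [_ *: 1]mulr1.
Qed.

Lemma has_gradient_continuous f x w :
  has_gradient f x w -> {for x, continuous f}.
Proof. by case=> /differentiable_continuous. Qed.

Lemma has_gradient_neq0 f x w : has_gradient f x w -> f x != 0 ->
  \forall y \near x, f y != 0.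
Proof.
move=> /has_gradient_continuous cf f0.
have : \forall z \near f x, z != 0.
  apply: (@open_nbhs_nbhs _ (f x) [set z | z != 0]).
  by split => //; exact: open_neq.
exact: cf.
Qed.

Lemma has_gradient_near f g x w : {near x, f =1 g} -> has_gradient g x w ->
  has_gradient f x w.
Proof. exact: near_eq_is_diff. Qed.

End GradientCalculus.

(** * Half-angle tangents of plane vectors *)

Section PlaneVectors.
Variable R : realType.
Implicit Types (a b e f p q x : 'rV[R]_2).

Lemma dotvv_ge0 a : 0 <= dot a a.
Proof. by rewrite /dot -!expr2 addr_ge0 ?sqr_ge0. Qed.

Lemma sqr_enorm a : enorm a ^+ 2 = dot a a.
Proof. by rewrite sqr_sqrtr ?dotvv_ge0. Qed.

Lemma dotvv_eq0 a : dot a a = 0 -> a = 0.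
Proof.
move/eqP; rewrite /dot -!expr2 paddr_eq0 ?sqr_ge0 // !sqrf_eq0.
case/andP => /eqP a0 /eqP a1; apply/rowP => j; rewrite mxE.
by case: (ord2_cases j) => ->.
Qed.

Lemma enorm_eq0 a : (enorm a == 0) = (a == 0).
Proof.
apply/idP/idP => /eqP a0; apply/eqP.
  by apply: dotvv_eq0; rewrite -sqr_enorm a0 expr0n.
by rewrite a0 /enorm /dot !mxE mulr0 addr0 sqrtr0.
Qed.

Lemma dotZ k l a b : dot (k *: a) (l *: b) = k * l * dot a b.
Proof. rewrite /dot !mxE; ring. Qed.

Lemma crossZ k l a b : cross (k *: a) (l *: b) = k * l * cross a b.
Proof. rewrite /cross !mxE; ring. Qed.

Lemma dot_cross_sqr a b : dot a b ^+ 2 + cross a b ^+ 2 = dot a a * dot b b.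
Proof. rewrite /dot /cross; ring. Qed.

Lemma dot_unit a : enorm a != 0 ->
  dot ((enorm a)^-1 *: a) ((enorm a)^-1 *: a) = 1.
Proof. by move=> a0; rewrite dotZ -sqr_enorm; field. Qed.

(** The tangent of half the signed angle from [a] to [b]; being built from
    [cross], [dot] and [enorm] only, it can be differentiated. *)
Definition tan_half a b : R := cross a b / (enorm a * enorm b + dot a b).

Lemma tan_halfC a b : tan_half b a = - tan_half a b.
Proof.
rewrite /tan_half (_ : cross b a = - cross a b); last by rewrite /cross; ring.
rewrite (mulrC (enorm b)) (_ : dot b a = dot a b) ?mulNr //.
by rewrite /dot; ring.
Qed.

Lemma tan_half_angle (al : R) :
  1 + cos al != 0 -> tan (al / 2) = sin al / (1 + cos al).
Proof.
have : al = (al / 2) *+ 2 by rewrite -mulr_natr; field.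
move: (al / 2) => be ->; rewrite sin_mulr2n cos_mulr2n -[_ ^+ 2 *+ 2]mulr_natr /tan => c0.
have c1 : cos be != 0.
  by apply: contra c0 => /eqP ->; apply/eqP; ring.
by field; rewrite c0 c1.
Qed.

(** The identity [1 + tan^2 = 1 / cos^2] at the half angle, for
    [c = cos alpha] and [s = sin alpha]. *)
Lemma one_plus_sqr_tan_half (c s : R) : c ^+ 2 + s ^+ 2 = 1 -> 1 + c != 0 ->
  1 + (s / (1 + c)) ^+ 2 = 2 / (1 + c).
Proof.
move=> cs1 c0.
have -> : 1 + (s / (1 + c)) ^+ 2 =
    (1 + 2 * c + (c ^+ 2 + s ^+ 2)) / (1 + c) ^+ 2 by field.
by rewrite cs1; field.
Qed.

(** The witness is [2 * atan t], with [t] the half-angle tangent: it lies in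
    the required interval because [atan] takes values in ]-pi/2, pi/2[. *)
Lemma signed_angle_exists e f : dot e e = 1 -> dot f f = 1 -> 1 + dot e f != 0 ->
  exists al : R,
    [/\ - pi < al < pi, cos al = dot e f & sin al = cross e f].
Proof.
move=> e1 f1 s0; pose t := cross e f / (1 + dot e f).
have h : dot e f ^+ 2 + cross e f ^+ 2 = 1.
  by rewrite dot_cross_sqr e1 f1 mulr1.
have ht : 1 + t ^+ 2 = 2 / (1 + dot e f) by exact: one_plus_sqr_tan_half.
pose be := atan t.
have cbe : cos be != 0.
  by rewrite gt_eqF // cos_gt0_pihalf // atan_gtNpi2 atan_ltpi2.
have tbe : tan be = t by exact: atanK.
have c2 : cos be ^+ 2 = (1 + dot e f) / 2.
  have := cos2_tan2 cbe; rewrite tbe ht => /(congr1 GRing.inv).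
  by rewrite invrK => ->; field.
exists (be *+ 2); split.
- rewrite -mulr_natr; have := atan_gtNpi2 t; have := atan_ltpi2 t.
  by rewrite -/be => h1 h2; apply/andP; split; lra.
- by rewrite cos_mulr2n c2 -mulr_natr; field.
- have -> : sin (be *+ 2) = 2 * tan be * cos be ^+ 2.
    by rewrite sin_mulr2n /tan -mulr_natr; field.
  by rewrite tbe c2 /t; field.
Qed.

(** By [tan_half_angle], every angle with the prescribed sine and cosine has the
    same half-angle tangent, so existence of such an angle is enough to
    evaluate the choice made by [signed_angle]. *)
Lemma tan_signed_angle a b : enorm a != 0 -> enorm b != 0 ->
  enorm a * enorm b + dot a b != 0 ->
  tan (signed_angle ((enorm a)^-1 *: a) ((enorm b)^-1 *: b) / 2) = tan_half a b.
Proof.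
move=> a0 b0 s0; set e := _ *: a; set f := _ *: b.
have D : 1 + dot e f = (enorm a * enorm b + dot a b) / (enorm a * enorm b).
  by rewrite dotZ; field; rewrite a0 b0.
have ef0 : 1 + dot e f != 0 by rewrite D mulf_neq0 // invr_neq0 // mulf_neq0.
have /xgetPex : exists al : R,
    [/\ - pi < al < pi, cos al = dot e f & sin al = cross e f].
  by apply: signed_angle_exists; rewrite ?dot_unit.
move=> /(_ 0); rewrite -/(signed_angle e f) => -[_ ca sa].
rewrite tan_half_angle ca // sa D crossZ /tan_half.
by field; rewrite s0 a0 b0.
Qed.

(** In the frame [(e, perp e)] the vector [f] has the coordinates
    [cos alpha], [sin alpha], here in their rational parametrisation by the
    half-angle tangent.  This eliminates the constraint [|f| = 1]. *)
Lemma half_angle_frame e f (t := cross e f / (1 + dot e f)) :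
  dot e e = 1 -> dot f f = 1 -> 1 + dot e f != 0 ->
  f = ((1 - t ^+ 2) / (1 + t ^+ 2)) *: e + (2 * t / (1 + t ^+ 2)) *: perp e.
Proof.
move=> e1 f1 s0.
have cs1 : dot e f ^+ 2 + cross e f ^+ 2 = 1.
  by rewrite dot_cross_sqr e1 f1 mulr1.
have ht := one_plus_sqr_tan_half cs1 s0.
have -> : 1 - t ^+ 2 = 2 - (1 + t ^+ 2) by ring.
rewrite ht (_ : (2 - _) / _ = dot e f); last by field.
rewrite (_ : 2 * t / _ = cross e f); last by rewrite /t; field.
apply/rowP => j; rewrite !mxE.
have : dot e e * f 0 j = f 0 j by rewrite e1 mul1r.
by case: (ord2_cases j) => -> /= <-; rewrite /dot /cross; ring.
Qed.

(** If the expression vanishes, then Cauchy-Schwarz holds with equality and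
    with the negative sign for [p - x] and [q - x].  These vectors are then
    opposite in direction, which puts [x] between [p] and [q]. *)
Lemma off_segment_neq0 p q x : x != p -> x != q ->
  (forall s, 0 <= s <= 1 -> x <> p + s *: (q - p)) ->
  enorm (p - x) * enorm (q - x) + dot (p - x) (q - x) != 0.
Proof.
move=> xp xq off; set a := p - x; set b := q - x.
set r := enorm a; set r' := enorm b.
have a0 : 0 < r by rewrite lt_def sqrtr_ge0 enorm_eq0 subr_eq0 eq_sym xp.
have b0 : 0 < r' by rewrite lt_def sqrtr_ge0 enorm_eq0 subr_eq0 eq_sym xq.
apply/eqP => s0.
(* The square of this vector is [2 * r * r' * (r * r' + dot a b)]. *)
have /dotvv_eq0 z0 : dot (r' *: a + r *: b) (r' *: a + r *: b) = 0.
  have -> : dot (r' *: a + r *: b) (r' *: a + r *: b) =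
      r' ^+ 2 * dot a a + r ^+ 2 * dot b b + 2 * r * r' * dot a b.
    by rewrite /dot !mxE; ring.
  rewrite -!sqr_enorm -/r -/r'.
  transitivity (2 * r * r' * (r * r' + dot a b)); first by ring.
  by rewrite s0 mulr0.
have rr : r + r' != 0 by rewrite gt_eqF // addr_gt0.
(* [x] divides the segment in the ratio of its distances to the end points. *)
apply: (off (r / (r + r'))).
  rewrite divr_ge0 ?ler_pdivrMr /= ?mul1r ?lerDl ?addr_gt0 // ?ltW //.
  exact: addr_gt0.
apply/rowP => j; have := congr1 (fun v : 'rV[R]_2 => v 0 j) z0.
rewrite /a /b !mxE => zj; apply/eqP; rewrite -subr_eq0.
have -> : x 0 j - (p 0 j + r / (r + r') * (q 0 j - p 0 j)) =
  - (r' * (p 0 j - x 0 j) + r * (q 0 j - x 0 j)) / (r + r') by field.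
by rewrite zj oppr0 mul0r.
Qed.

End PlaneVectors.

(** * Gradient of a half-angle tangent over a distance *)

Section GradientTanHalf.
Variable R : realType.
Implicit Types (p q x : 'rV[R]_2).

Lemma has_gradient_dotB p q x :
  has_gradient (fun y => dot (p - y) (q - y)) x (- (p - x) - (q - x)).
Proof.
have d (u : 'rV[R]_2) j :=
  has_gradientB (has_gradient_cst (u 0 j) x) (has_gradient_coord j x).
have := has_gradientD (has_gradientM (d p 0) (d q 0))
  (has_gradientM (d p 1) (d q 1)).
have -> : (fun y : 'rV[R]_2 => dot (p - y) (q - y)) = (fun y =>
    (p 0 0 - y 0 0) * (q 0 0 - y 0 0) + (p 0 1 - y 0 1) * (q 0 1 - y 0 1)).
  by apply/funext => y; rewrite /dot !mxE.
move/has_gradient_eq; apply; apply/rowP => j; rewrite !mxE.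
by case: (ord2_cases j) => -> /=; ring.
Qed.

Lemma has_gradient_crossB p q x :
  has_gradient (fun y => cross (p - y) (q - y)) x (perp (q - p)).
Proof.
have d (u : 'rV[R]_2) j :=
  has_gradientB (has_gradient_cst (u 0 j) x) (has_gradient_coord j x).
have := has_gradientB (has_gradientM (d p 0) (d q 1))
  (has_gradientM (d p 1) (d q 0)).
have -> : (fun y : 'rV[R]_2 => cross (p - y) (q - y)) = (fun y =>
    (p 0 0 - y 0 0) * (q 0 1 - y 0 1) - (p 0 1 - y 0 1) * (q 0 0 - y 0 0)).
  by apply/funext => y; rewrite /cross !mxE.
move/has_gradient_eq; apply; apply/rowP => j; rewrite !mxE.
by case: (ord2_cases j) => -> /=; ring.
Qed.

Lemma has_gradient_dist p x : enorm (p - x) != 0 ->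
  has_gradient (fun y => enorm (p - y)) x (- ((enorm (p - x))^-1 *: (p - x))).
Proof.
move=> r0.
have d0 : 0 < dot (p - x) (p - x).
  by rewrite -sqr_enorm lt_def sqr_ge0 sqrf_eq0 r0.
have := has_gradient_sqrt (has_gradient_dotB p p x) d0.
move/has_gradient_eq; apply.
by rewrite -/(enorm (p - x)); apply/rowP => j; rewrite !mxE; field.
Qed.

(** The quotient rule gives an expression in [a], [b] and their lengths; the
    substitutions [a = r e], [b = r' f] and [half_angle_frame] turn it into a
    rational identity in [t], [r], [r'], linear in the coordinates of [e]. *)
Lemma has_gradient_tan_half_dist p q x
    (a := p - x) (b := q - x) (r := enorm a) (r' := enorm b) (t := tan_half a b) :
  r != 0 -> r' != 0 -> r * r' + dot a b != 0 ->
  has_gradient (fun y => tan_half (p - y) (q - y) / enorm (p - y)) x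
    (r ^- 2 *: perp (r^-1 *: a)
     - (2 * r)^-1 *: (((r^-1 + r'^-1) * (1 + t ^+ 2)) *: perp (r'^-1 *: b))).
Proof.
move=> r0 r'0 s0.
have dr := has_gradient_dist r0; have dr' := has_gradient_dist r'0.
have ds := has_gradientD (has_gradientM dr dr') (has_gradient_dotB p q x).
have dt := has_gradientM (has_gradient_crossB p q x) (has_gradientV ds s0).
have := has_gradientM dt (has_gradientV dr r0).
move/has_gradient_eq; apply.
rewrite -/a -/b -/r -/r'.
(* Rewrite every quantity in terms of [r], [r'], [t] and the unit vector [e]. *)
pose e := r^-1 *: a; pose f := r'^-1 *: b.
have aE : a = r *: e by rewrite scalerA divff // scale1r.
have bE : b = r' *: f by rewrite scalerA divff // scale1r.
have sE : r * r' + dot a b = r * r' * (1 + dot e f).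
  by rewrite aE bE dotZ; ring.
have ef0 : 1 + dot e f != 0.
  by move: s0; rewrite sE mulf_eq0 negb_or => /andP[].
have tE : t = cross e f / (1 + dot e f).
  by rewrite /t /tan_half -/r -/r' sE aE bE crossZ; field; rewrite ef0 r0 r'0.
have e1 : dot e e = 1 by exact: dot_unit.
have f1 : dot f f = 1 by exact: dot_unit.
have cs1 : dot e f ^+ 2 + cross e f ^+ 2 = 1.
  by rewrite dot_cross_sqr e1 f1 mulr1.
have t0 : 1 + t ^+ 2 != 0.
  by rewrite tE one_plus_sqr_tan_half // mulf_neq0 ?invr_neq0 // pnatr_eq0.
have c1 : 1 + dot e f = 2 / (1 + t ^+ 2).
  by rewrite tE one_plus_sqr_tan_half //; field.
have fE := half_angle_frame e1 f1 ef0; rewrite -tE in fE.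
have CE : cross a b = t * (r * r' + dot a b) by rewrite /t /tan_half -/r -/r'; field.
have bpE : q - p = r' *: f - r *: e.
  by rewrite -aE -bE; apply/rowP => j; rewrite !mxE; ring.
rewrite bpE CE -/t sE c1 -/e -/f aE bE.
rewrite fE; apply/rowP => j; rewrite !mxE; case: (ord2_cases j) => -> /=.
all: by field; rewrite r0 r'0 t0.
Qed.

End GradientTanHalf.

(** * The gradient of the mean value weights *)

Theorem theorem2 (R : realType) (n : nat) (p : 'I_n -> 'rV[R]_2)
  (hsimple : simple_polygonal_curve p) (hccw : anticlockwise p)
  (x : 'rV[R]_2) (hx : polygon_region p x) (i : 'I_n) :
  differentiable (mv_w p i) x /\
  gradient (mv_w p i) x =
    (2 * mv_r p i x)^-1 *:
      (mv_u p (ord_pred i) x *: perp (mv_e p (ord_pred i) x)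
       - mv_u p i x *: perp (mv_e p (ordS i) x)).
Proof.
have vertex0 j : mv_r p j x != 0.
  rewrite enorm_eq0 subr_eq0; apply/eqP => pj; case: hx => hx _; apply: hx.
  by exists j, 0; rewrite lexx ler01 /edge_point scale0r addr0.
have edge0 j : mv_r p j x * mv_r p (ordS j) x
    + dot (p j - x) (p (ordS j) - x) != 0.
  apply: off_segment_neq0.
  - by rewrite eq_sym -subr_eq0 -enorm_eq0 vertex0.
  - by rewrite eq_sym -subr_eq0 -enorm_eq0 vertex0.
  - by move=> s s01 xs; case: hx => hx _; apply: hx; exists j, s.
have vertex_near j : \forall y \near x, mv_r p j y != 0.
  exact: has_gradient_neq0 (has_gradient_dist (vertex0 j)) (vertex0 j).
have tE j : \forall y \near x, mv_t p j y = tan_half (p j - y) (p (ordS j) - y).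
  have D := has_gradientD
    (has_gradientM (has_gradient_dist (vertex0 j))
       (has_gradient_dist (vertex0 (ordS j))))
    (has_gradient_dotB (p j) (p (ordS j)) x).
  near=> y; apply: tan_signed_angle.
  - by near: y; exact: vertex_near.
  - by near: y; exact: vertex_near.
  - by near: y; exact: has_gradient_neq0 D (edge0 j).
have tEx j : mv_t p j x = tan_half (p j - x) (p (ordS j) - x).
  exact: nbhs_singleton (tE j).
pose k := ord_pred i.
have ki : ordS k = i by exact: ord_predK.
(* [tan_half] is antisymmetric: the edge ending at [p i] is traversed backwards,
   so that both terms are centred at [p i]. *)
have wE : {near x, mv_w p i =1 (fun y =>
    tan_half (p i - y) (p (ordS i) - y) / enorm (p i - y)
    - tan_half (p i - y) (p k - y) / enorm (p i - y))}.
  near=> y; rewrite /mv_w.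
  rewrite (_ : mv_t p i y = tan_half (p i - y) (p (ordS i) - y)); last first.
    by near: y; exact: tE.
  rewrite (_ : mv_t p k y = tan_half (p k - y) (p (ordS k) - y)); last first.
    by near: y; exact: tE.
  by rewrite ki [tan_half (p k - y) _]tan_halfC mulrDl mulNr addrC.
have edgek : mv_r p i x * mv_r p k x + dot (p i - x) (p k - x) != 0.
  have := edge0 k; rewrite ki mulrC; congr (_ + _ != _).
  by rewrite /dot; ring.
have dw := has_gradient_near wE (has_gradientB
  (has_gradient_tan_half_dist (vertex0 i) (vertex0 (ordS i)) (edge0 i))
  (has_gradient_tan_half_dist (vertex0 i) (vertex0 k) edgek)).
split; first by case: dw.
(* The two vectors [r^-2 *: perp e] of the gradients cancel in the difference. *)
rewrite (has_gradientE dw) /mv_u -/k ki !tEx ki [tan_half (p k - x) _]tan_halfC sqrrN.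
rewrite /mv_e /mv_r.
rewrite (addrC (enorm (p k - x))^-1).
apply/rowP => j; rewrite !mxE; case: ifP => _; ring.
Unshelve. all: by end_near. Qed.
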